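(* For any dominant weight $\nu\in P_{+}$ and any weight $\mu\in P$, written $\mu=\overline\mu+\mu^{\diamondsuit}$, there exists a nonnegative integer $k_{0}$ such that, for any $k\geq k_{0}$, $$K_{\nu+k\rho^{\diamondsuit},\mu+k\rho^{\diamondsuit}}(p,q)=\sum_{\overline{\lambda}\in\overline{P}_{+}}b_{\nu,\overline{\lambda}+\mu^{\diamondsuit}}^{\mathrm{stab}}(p)\,\overline{K}_{\overline{\lambda},\overline{\mu}}(q).$$ In particular, the stabilized double deformation $K_{\nu,\mu}^{\mathrm{stab}}(p,q):=K_{\nu+k\rho^{\diamondsuit},\mu+k\rho^{\diamondsuit}}(p,q)$ does not depend on $k\geq k_{0}$.
   Context: $\mathfrak{g}$ is a finite-dimensional simple Lie algebra over $\mathbb{C}$ with root system $R$ in a Euclidean space $E$ with scalar product $\langle\cdot,\cdot\rangle$, positive roots $R_+$, simple roots $\alpha_i$ ($i\in I$), fundamental weights $\omega_i$ ($i\in I$), Weyl group $W$ with sign character $\varepsilon$, weight lattice $P$, dominant weights $P_+=\bigoplus_{i\in I}\mathbb{N}\omega_i$, $\rho=\frac12\sum_{\alpha\in R_+}\alpha=\sum_{i\in I}\omega_i$. Fix a subset $\overline{I}\subset I$. Let $\overline{R}$ be the parabolic root subsystem with simple roots $\alpha_i$, $i\in\overline I$, $\overline R_+=\overline R\cap R_+$, $\overline W=\langle s_i\mid i\in\overline I\rangle$, and $\overline P_+=\{\delta\in P\mid\langle\delta,\alpha_i\rangle\ge 0,\ i\in\overline I\}=\bigoplus_{i\in\overline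 I}\mathbb{N}\omega_i\oplus\bigoplus_{i\in I\setminus\overline I}\mathbb{Z}\omega_i$. Each $v\in E$ is written uniquely as $v=\overline v+v^{\diamondsuit}$ with $\overline v\in\bigoplus_{i\in\overline I}\mathbb{R}\omega_i$ and $v^{\diamondsuit}\in\bigoplus_{i\in I\setminus\overline I}\mathbb{R}\omega_i$. In particular $\overline\rho=\sum_{i\in\overline I}\omega_i$ and $\rho^{\diamondsuit}=\sum_{i\in I\setminus\overline I}\omega_i$. Let $p,q$ be indeterminates. Partition functions are defined by $$\prod_{\alpha\in R_+\setminus\overline R_+}\frac1{1-pe^\alpha}\prod_{\alpha\in\overline R_+}\frac1{1-qe^\alpha}=\sum_{\beta}\mathrm P_{p,q}(\beta)e^\beta,\quad \prod_{\alpha\in R_+\setminus\overline R_+}\frac1{1-pe^\alpha}=\sum_{\eta}\hat{\mathrm P}_p(\eta)e^\eta,\quad \prod_{\alpha\in\overline R_+}\frac1{1-qe^\alpha}=\sum_{\delta}\overline{\mathrm P}_q(\delta)e^\delta,$$ and each is $0$ on weights not appearing in the expansion. For $\nu\in P_+$, $\mu\in P$, $\kappa\in P$ set $$K_{\nu,\mu}(p,q)=\sum_{w\in W}\varepsilon(w)\mathrm P_{p,q}(w(\nu+\rho)-\mu-\rho),\qquad b_{\nu,\kappa}(p)=\sum_{w\in W}\varepsilon(w)\hat{\mathrm P}_p(w(\nu+\rho)-\kappa-\rho),$$ and for $\kappa,\mu\in P$ set $$\overline K_{\kappa,\mu}(q)=\sum_{\overline w\in\overline W}\varepsilon(\overline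 w)\overline{\mathrm P}_q(\overline w(\kappa+\overline\rho)-\mu-\overline\rho).$$ For $\nu\in P_+$ and $\kappa\in\overline P_+$, the polynomial $b_{\nu+k\rho^{\diamondsuit},\kappa+k\rho^{\diamondsuit}}(p)$ is independent of $k$ for $k$ large enough, and $b^{\mathrm{stab}}_{\nu,\kappa}(p)$ denotes this eventual value; it equals $\sum_{\overline w\in\overline W}\varepsilon(\overline w)\hat{\mathrm P}_p(\overline w(\nu+\overline\rho)-(\kappa+\overline\rho))$. In the sum of the claim $\overline\lambda$ is a summation variable running over all of $\overline P_+$. *)

(* Defs.v *)
From HB Require Import structures.
From mathcomp Require Import all_boot all_order all_algebra.
From mathcomp Require Import boolp classical_sets functions cardinality fsbigop.
From mathcomp Require Import reals.
Set Implicit Arguments.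
Unset Strict Implicit.
Unset Printing Implicit Defensive.
Import Order.TTheory GRing.Theory Num.Theory.
Local Open Scope classical_set_scope.
Local Open Scope ring_scope.

Section Euclidean.
Context {R : realType} {n : nat}.
Implicit Types u v a : 'rV[R]_n.

Definition dot u v : R := (u *m v^T) 0 0.

(* cpair v a = <v, a^vee>, where a^vee = 2 a / <a, a> is the coroot of a. *)
Definition cpair v a : R := 2 * dot v a / dot a a.

Definition refl a v : 'rV[R]_n := v - cpair v a *: a.

End Euclidean.

(* The root system of a simple Lie algebra of rank n, together with a choice of
   simple roots: an irreducible reduced crystallographic root system spanning
   the Euclidean space R^n, a base of it and the fundamental weights, which
   are the dual basis of the simple coroots. *)
Record rootSystem (R : realType) (n : nat) := RootSystem {
  roots : seq 'rV[R]_n;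
  simple_root : 'I_n -> 'rV[R]_n;
  fund_weight : 'I_n -> 'rV[R]_n;
  roots_uniq : uniq roots;
  roots_neq_nil : roots != [::];
  roots_neq0 : 0 \notin roots;
  roots_span : <<roots>>%VS = fullv;
  roots_refl : forall a b, a \in roots -> b \in roots -> refl a b \in roots;
  roots_int : forall a b, a \in roots -> b \in roots ->
    cpair b a \is a Num.int;
  roots_reduced : forall a (c : R), a \in roots -> c *: a \in roots ->
    c = 1 \/ c = -1;
  roots_irreducible : forall A : pred 'rV[R]_n,
    (forall a b, a \in roots -> b \in roots -> A a -> ~~ A b -> dot a b = 0) ->
    {in roots, forall a, A a} \/ {in roots, forall a, ~~ A a};
  simple_root_in : forall i, simple_root i \in roots;
  simple_root_base : forall a, a \in roots -> exists c : 'I_n -> nat,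
    a = \sum_i (c i)%:R *: simple_root i \/
    a = - \sum_i (c i)%:R *: simple_root i;
  fund_weight_dual : forall i j,
    cpair (fund_weight i) (simple_root j) = (i == j)%:R
}.

Section RootData.
Context {R : realType} {n : nat}.
Variable S : rootSystem R n.
Local Notation E := 'rV[R]_n.
Local Notation alpha := (simple_root S).
Local Notation omega := (fund_weight S).
Implicit Types (J : {set 'I_n}) (a v : E).

Definition pos_roots : seq E :=
  [seq a <- roots S | `[< exists c : 'I_n -> nat,
                            a = \sum_i (c i)%:R *: alpha i >]].

(* Membership in the parabolic subsystem with simple roots alpha_i, i in J. *)
Definition in_parabolic J : pred E :=
  fun a => (a \in roots S) &&
    `[< exists c : 'I_n -> int, a = \sum_(i in J) (c i)%:~R *: alpha i >].

Definition weights : set E :=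
  [set v | exists c : 'I_n -> int, v = \sum_i (c i)%:~R *: omega i].

Definition dominant : set E :=
  [set v | exists c : 'I_n -> nat, v = \sum_i (c i)%:R *: omega i].

Definition dominant_bar J : set E :=
  [set v | weights v /\ forall i, i \in J -> 0 <= dot v (alpha i)].

(* v = bar J v + dia J v: the components of v along the omega_i with i in J,
   resp. with i not in J, in the basis of fundamental weights. *)
Definition omega_coord (i : 'I_n) v : R := coord [tuple omega j | j < n] i v.
Definition bar J v : E := \sum_(i in J) omega_coord i v *: omega i.
Definition dia J v : E := \sum_(i in ~: J) omega_coord i v *: omega i.

Definition rho : E := 2^-1 *: \sum_(a <- pos_roots) a.

(* The subgroup of the Weyl group generated by the s_i with i in J, as a set of
   matrices acting on row vectors on the right; words in the s_i suffice since
   each s_i is an involution. The whole Weyl group is weyl [set: 'I_n]. *)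
Definition weyl J : set 'M[R]_n :=
  [set w | exists2 s : seq 'I_n, all (mem J) s
         & w = \big[mulmx/1%:M]_(i <- s) lin1_mx (refl (alpha i))].

End RootData.

(* Z[p, q] as Z[p][q] *)
Notation Zpq := {poly {poly int}}.
Definition indet_p : Zpq := 'X%:P.
Definition indet_q : Zpq := 'X.

(* The sign character w |-> det w = +-1, with values in Z[p, q]. *)
Definition sign_char {R : realType} {n : nat} (w : 'M[R]_n) : Zpq :=
  (sgz (\det w))%:~R.

(* Formal series sum_beta f(beta) e^beta over Z[p, q] are functions of beta.
   Infinite-support sums default to 0 in fsbigop, but every product used below
   is between series supported in the cone spanned by positive roots, so only
   finitely many terms contribute to each coefficient. *)
Section FormalSeries.
Context {R : realType} {n : nat}.
Local Notation E := 'rV[R]_n.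
Implicit Types (f g : E -> Zpq).

Definition series1 : E -> Zpq := fun b => (b == 0)%:R.

Definition series_mul f g : E -> Zpq :=
  fun b => \sum_(a \in [set: E]) f a * g (b - a).

(* 1 / (1 - c e^a) = sum_m c^m e^(m a) *)
Definition geometric (c : Zpq) (a : E) : E -> Zpq :=
  fun b => \sum_(m \in [set m : nat | a *+ m = b]) c ^+ m.

Definition geometric_prod (c : Zpq) (s : seq E) : E -> Zpq :=
  \big[series_mul/series1]_(a <- s) geometric c a.

End FormalSeries.

Section Deformations.
Context {R : realType} {n : nat}.
Variables (S : rootSystem R n) (J : {set 'I_n}).
Local Notation E := 'rV[R]_n.
Local Notation rho := (rho S).
Local Notation rho_bar := (bar S J rho).
Local Notation rho_dia := (dia S J rho).
Implicit Types nu mu kappa : E.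

Definition part_hat : E -> Zpq :=
  geometric_prod indet_p [seq a <- pos_roots S | ~~ in_parabolic S J a].

Definition part_bar : E -> Zpq :=
  geometric_prod indet_q [seq a <- pos_roots S | in_parabolic S J a].

Definition part_pq : E -> Zpq := series_mul part_hat part_bar.

Definition Kpq nu mu : Zpq :=
  \sum_(w \in weyl S [set: 'I_n])
    sign_char w * part_pq ((nu + rho) *m w - mu - rho).

Definition bp nu kappa : Zpq :=
  \sum_(w \in weyl S [set: 'I_n])
    sign_char w * part_hat ((nu + rho) *m w - kappa - rho).

Definition Kbar kappa mu : Zpq :=
  \sum_(w \in weyl S J)
    sign_char w * part_bar ((kappa + rho_bar) *m w - mu - rho_bar).

(* The eventual value of bp (nu + k rho_dia) (kappa + k rho_dia) for k large
   (with default 0 if there were none). *)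
Definition bstab nu kappa : Zpq :=
  xget 0 [set x | exists k0 : nat, forall k : nat, (k0 <= k)%N ->
    bp (nu + rho_dia *+ k) (kappa + rho_dia *+ k) = x].

End Deformations.

(* Main.v *)
Require Import Defs.
From HB Require Import structures.
From mathcomp Require Import all_boot all_order all_algebra.
From mathcomp Require Import boolp classical_sets functions cardinality fsbigop.
From mathcomp Require Import reals.
From mathcomp Require Import ring lra.
Set Implicit Arguments.
Unset Strict Implicit.
Unset Printing Implicit Defensive.
Import Order.TTheory GRing.Theory Num.Theory.
Local Open Scope classical_set_scope.
Local Open Scope ring_scope.

(** Write [d] for [rho_dia] and [W_J] for the parabolic subgroup [weyl S J].

    Stabilization.  In the sum defining K at (nu + k d, mu + k d), the argument
    of the partition function for [w] is X + k (w d - d) with X independent of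
    k.  If [w] fixes [d] the term does not depend on k.  Otherwise, [w] being an
    isometry, the scalar product of w d - d with the dominant vector [d] is
    negative, while every vector of the root cone, which contains the support of
    the partition function, has a nonnegative scalar product with [d]; so the
    term vanishes for large k.  The stabilizer of [d] in W is W_J
    ([weyl_stabilizer]), hence only W_J survives ([weyl_sum_stable]).  The same
    argument applied to b evaluates the stable b as the alternating sum
    [alt_hat], A(x) = sum over w in W_J of eps(w) hat P(w (nu + rho_bar) - x),
    taken at kappa + rho_bar ([bstabE]).

    Branching.  Expanding P_{p,q} as the product of hat P and bar P and
    exchanging the two finite sums, the stable K becomes the sum over all x of
    A(x) bar P(x - mu - rho_bar) ([stable_sum_regroup]).  Since W_J permutes
    R_+ minus the parabolic subsystem, hat P is W_J-invariant
    ([part_hat_srefl]), so A is antisymmetric under W_J ([alt_hat_weyl]) and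
    vanishes on the walls.  The remaining x are, uniquely, of the form
    (lambda + mu_dia + rho_bar) u with lambda in bar P_+ and u in W_J
    ([chamber_map_inj], [chamber_map_surj]).  For fixed lambda, A contributes
    eps(u) A(lambda + mu_dia + rho_bar), which is eps(u) times the stable b, and
    the sum over u of eps(u) bar P is bar K ([branching_sum]).

    The invariance of hat P requires that a product of geometric series does not
    depend on the order of its factors.  Instead of rearranging infinite sums,
    such a product is characterized as the only series F supported in a half
    space for which applying all the operators 1 - c e^a gives 1
    ([one_sub_shift_inj]); these operators commute. *)

(** * Scalar product and reflections *)
Section Reflections.
Context {R : realType} {n : nat}.
Local Notation E := 'rV[R]_n.
Implicit Types (u v a : E) (w : 'M[R]_n).

Lemma dotE u v : dot u v = \sum_j u 0 j * v 0 j.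
Proof. by rewrite /dot mxE; apply: eq_bigr => j _; rewrite mxE. Qed.

Lemma dotC u v : dot u v = dot v u.
Proof. by rewrite !dotE; apply: eq_bigr => j _; rewrite mulrC. Qed.

Lemma dotDl u v a : dot (u + v) a = dot u a + dot v a.
Proof. by rewrite /dot mulmxDl mxE. Qed.

Lemma dotZl c u v : dot (c *: u) v = c * dot u v.
Proof. by rewrite /dot -scalemxAl mxE. Qed.

Lemma dotNl u v : dot (- u) v = - dot u v.
Proof. by rewrite -scaleN1r dotZl mulN1r. Qed.

Lemma dotDr u v a : dot a (u + v) = dot a u + dot a v.
Proof. by rewrite ![dot a _]dotC dotDl. Qed.

Lemma dotZr c u v : dot u (c *: v) = c * dot u v.
Proof. by rewrite ![dot u _]dotC dotZl. Qed.

Lemma dotNr u v : dot u (- v) = - dot u v.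
Proof. by rewrite ![dot u _]dotC dotNl. Qed.

Lemma dot0l v : dot 0 v = 0.
Proof. by rewrite /dot mul0mx mxE. Qed.

Lemma dot_suml (I : Type) (r : seq I) (P : pred I) (F : I -> E) v :
  dot (\sum_(i <- r | P i) F i) v = \sum_(i <- r | P i) dot (F i) v.
Proof. by rewrite /dot mulmx_suml summxE. Qed.

Lemma dot_ge0 v : 0 <= dot v v.
Proof. by rewrite dotE sumr_ge0 // => j _; rewrite -expr2 sqr_ge0. Qed.

Lemma dot_eq0 v : dot v v = 0 -> v = 0.
Proof.
rewrite dotE => /psumr_eq0P h; apply/rowP => j; rewrite mxE.
by apply/eqP; rewrite -sqrf_eq0 expr2 h // => i _; rewrite -expr2 sqr_ge0.
Qed.

Lemma dot_gt0 v : v != 0 -> 0 < dot v v.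
Proof.
by move=> v0; rewrite lt0r dot_ge0 andbT; apply: contra_neq v0; apply: dot_eq0.
Qed.

Lemma cpairDl u v a : cpair (u + v) a = cpair u a + cpair v a.
Proof. by rewrite /cpair dotDl mulrDr mulrDl. Qed.

Lemma cpairZl c v a : cpair (c *: v) a = c * cpair v a.
Proof. by rewrite /cpair dotZl mulrCA -!mulrA. Qed.

Lemma cpairNl v a : cpair (- v) a = - cpair v a.
Proof. by rewrite -scaleN1r cpairZl mulN1r. Qed.

Lemma cpair_suml (I : Type) (r : seq I) (P : pred I) (F : I -> E) a :
  cpair (\sum_(i <- r | P i) F i) a = \sum_(i <- r | P i) cpair (F i) a.
Proof. by rewrite /cpair dot_suml mulr_sumr mulr_suml. Qed.

Lemma cpair_self a : a != 0 -> cpair a a = 2.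
Proof. by move=> /dot_gt0 h; rewrite /cpair mulfK // gt_eqF. Qed.

Lemma cpair_gt0 v a : a != 0 -> (0 < cpair v a) = (0 < dot v a).
Proof.
by move=> /dot_gt0 h; rewrite /cpair pmulr_lgt0 ?invr_gt0 // pmulr_rgt0 ?ltr0n.
Qed.

Lemma cpair_ge0 v a : a != 0 -> (0 <= cpair v a) = (0 <= dot v a).
Proof.
by move=> /dot_gt0 h; rewrite /cpair pmulr_lge0 ?invr_gt0 // pmulr_rge0 ?ltr0n.
Qed.

Fact refl_is_linear a : linear (refl a).
Proof.
move=> c u v; rewrite /refl cpairDl cpairZl scalerDl scalerBr scalerA.
by rewrite opprD addrACA.
Qed.
HB.instance Definition _ a := GRing.isLinear.Build R E E _ (refl a)
  (refl_is_linear a).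

Definition refl_mx a : 'M[R]_n := lin1_mx (refl a).

Lemma mul_refl_mx v a : v *m refl_mx a = refl a v.
Proof. exact: mul_rV_lin1. Qed.

Lemma mulmx_rV_inj w w' : (forall v, v *m w = v *m w') -> w = w'.
Proof.
by move=> h; apply/row_matrixP => i; rewrite !rowE h.
Qed.

Lemma dot_refl a u v : a != 0 -> dot (refl a u) (refl a v) = dot u v.
Proof.
move=> /dot_gt0 h; rewrite /refl !(dotDl, dotDr, dotNl, dotNr, dotZl, dotZr).
have -> : dot u a = cpair u a * dot a a / 2.
  by rewrite /cpair divfK ?gt_eqF // mulrC mulKf // pnatr_eq0.
rewrite (dotC a v); have -> : dot v a = cpair v a * dot a a / 2.
  by rewrite /cpair divfK ?gt_eqF // mulrC mulKf // pnatr_eq0.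
by field.
Qed.

Lemma refl_refl a v : a != 0 -> refl a (refl a v) = v.
Proof.
move=> a0; rewrite {1}/refl.
have -> : cpair (refl a v) a = - cpair v a.
  by rewrite /refl cpairDl cpairNl cpairZl cpair_self //; ring.
by rewrite scaleNr opprK /refl subrK.
Qed.

Lemma refl_mxK a : a != 0 -> refl_mx a *m refl_mx a = 1%:M.
Proof.
move=> a0; apply: mulmx_rV_inj => v.
by rewrite mulmxA !mul_refl_mx refl_refl // mulmx1.
Qed.

Lemma orthogonal_mulmx_tr w : (forall u v, dot (u *m w) (v *m w) = dot u v) ->
  w *m w^T = 1%:M.
Proof.
move=> h; apply/matrixP => i j; have := h (delta_mx 0 i) (delta_mx 0 j).
rewrite -!rowE {1}dotE [RHS]dotE => e; rewrite !mxE.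
transitivity (\sum_k row i w 0 k * row j w 0 k).
  by apply: eq_bigr => k _; rewrite !mxE.
rewrite e (bigD1 i) //= big1 => [|k /negPf ki]; rewrite !mxE ?eqxx /=.
  by rewrite mul1r addr0.
by rewrite ki mul0r.
Qed.

(** Both sides are the determinant of the block matrix (1, v; u^T, 1), factored
    into triangular matrices in two ways. *)
Lemma det_1_sub_outer u v : \det (1%:M - u^T *m v) = 1 - dot u v.
Proof.
pose A : 'M[R]_(1 + n) := block_mx 1%:M v u^T 1%:M.
have e1 : A = block_mx 1%:M 0 u^T 1%:M *m block_mx 1%:M v 0 (1%:M - u^T *m v).
  rewrite mulmx_block !mul1mx ?mulmx1 ?mul0mx ?mulmx0 ?addr0.
  by rewrite addrCA subrr addr0.
have e2 : A = block_mx (1%:M - v *m u^T) v 0 1%:M *m block_mx 1%:M 0 u^T 1%:M.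
  by rewrite mulmx_block ?mul1mx ?mulmx1 ?mul0mx ?mulmx0 ?add0r subrK.
have := erefl (\det A); rewrite {1}e1 e2 !det_mulmx !det_lblock !det_ublock.
by rewrite !det1 ?mul1r ?mulr1 => ->; rewrite det_mx11 dotC /dot !mxE eqxx.
Qed.

Lemma det_refl_mx a : a != 0 -> \det (refl_mx a) = -1.
Proof.
move=> a0; have := dot_gt0 a0 => h.
have -> : refl_mx a = 1%:M - (2 / dot a a *: a)^T *m a.
  apply: mulmx_rV_inj => v; rewrite mul_refl_mx mulmxBr mulmx1 /refl; congr (_ - _).
  rewrite mulmxA [v *m _]mx11_scalar mul_scalar_mx; congr (_ *: _).
  by rewrite -/(dot _ _) dotZr /cpair mulrAC.
by rewrite det_1_sub_outer dotZl divfK ?gt_eqF //; ring.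
Qed.

Lemma refl_mx_conj a w : w *m w^T = 1%:M ->
  refl_mx a *m w = w *m refl_mx (a *m w).
Proof.
move=> ww; apply: mulmx_rV_inj => v; rewrite !mulmxA !mul_refl_mx.
have hd x y : dot (x *m w) (y *m w) = dot x y.
  by rewrite /dot trmx_mul mulmxA -(mulmxA x) ww mulmx1.
by rewrite /refl mulmxBl -scalemxAl /cpair !hd.
Qed.

End Reflections.

(** * Coordinates on simple roots and fundamental weights *)
Section RootSystem.
Context {R : realType} {n : nat}.
Variable S : rootSystem R n.
Local Notation E := 'rV[R]_n.
Local Notation Phi := (Defs.roots S).
Local Notation alpha := (simple_root S).
Local Notation omega := (fund_weight S).
Implicit Types (J : {set 'I_n}) (u v a : E) (w : 'M[R]_n).

Lemma root_neq0 a : a \in Phi -> a != 0.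
Proof. by apply: contraTneq => ->; exact: roots_neq0. Qed.

Lemma alpha_neq0 i : alpha i != 0.
Proof. exact: root_neq0 (simple_root_in S i). Qed.

Lemma alpha_norm_gt0 i : 0 < dot (alpha i) (alpha i).
Proof. exact: dot_gt0 (alpha_neq0 i). Qed.

Lemma dot_alpha v i :
  dot v (alpha i) = cpair v (alpha i) * (dot (alpha i) (alpha i) / 2).
Proof.
by rewrite /cpair; have := alpha_norm_gt0 i; move=> /gt_eqF h; field; rewrite h.
Qed.

Let omegas := [tuple omega j | j < n].

Fact omegasE (j : 'I_n) : omegas`_j = omega j.
Proof. by rewrite -tnth_nth tnth_mktuple. Qed.

Lemma cpair_sum_omega (A : pred 'I_n) (c : 'I_n -> R) i :
  cpair (\sum_(j | A j) c j *: omega j) (alpha i) = if A i then c i else 0.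
Proof.
rewrite cpair_suml; case: ifP => iA.
  rewrite (bigD1 i) //= big1 => [|j /andP[_ /negPf ji]].
    by rewrite cpairZl fund_weight_dual eqxx mulr1 addr0.
  by rewrite cpairZl fund_weight_dual ji mulr0.
rewrite big1 // => j jA; rewrite cpairZl fund_weight_dual.
by case: eqP => [ji|_]; rewrite ?mulr0 //; rewrite -ji jA in iA.
Qed.

Lemma free_omegas : free omegas.
Proof.
apply/freeP => c c0 i; rewrite -[LHS](cpair_sum_omega predT c).
under eq_bigr do rewrite -omegasE.
by rewrite c0 /cpair dot0l mulr0 mul0r.
Qed.

Lemma omega_coordE i v : omega_coord S i v = cpair v (alpha i).
Proof.
have basisX : basis_of fullv omegas.
  by rewrite basisEfree free_omegas subvf size_tuple dimvf /dim /= mul1n leqnn.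
rewrite {2}(coord_basis basisX (memvf v)).
under eq_bigr do rewrite omegasE.
by rewrite (cpair_sum_omega predT).
Qed.

Lemma omega_decomposition v : v = \sum_i cpair v (alpha i) *: omega i.
Proof.
have basisX : basis_of fullv omegas.
  by rewrite basisEfree free_omegas subvf size_tuple dimvf /dim /= mul1n leqnn.
rewrite [LHS](coord_basis basisX (memvf v)).
by apply: eq_bigr => i _; rewrite omegasE -omega_coordE.
Qed.

Lemma barE J v : bar S J v = \sum_(i in J) cpair v (alpha i) *: omega i.
Proof. by apply: eq_bigr => i _; rewrite omega_coordE. Qed.

Lemma diaE J v : dia S J v = \sum_(i in ~: J) cpair v (alpha i) *: omega i.
Proof. by apply: eq_bigr => i _; rewrite omega_coordE. Qed.

Lemma bar_dia J v : bar S J v + dia S J v = v.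
Proof.
rewrite barE diaE [RHS]omega_decomposition [RHS](bigID (mem J)) /=.
by congr (_ + _); apply: eq_bigl => i; rewrite inE.
Qed.

Lemma cpair_bar J v i :
  cpair (bar S J v) (alpha i) = if i \in J then cpair v (alpha i) else 0.
Proof. by rewrite barE cpair_sum_omega. Qed.

Lemma cpair_dia J v i :
  cpair (dia S J v) (alpha i) = if i \in J then 0 else cpair v (alpha i).
Proof. by rewrite diaE cpair_sum_omega inE; case: (i \in J). Qed.

(** The coefficient of [alpha i] in [v]: up to the factor |alpha i|^2 / 2, the
    fundamental weights form the basis dual to the simple roots. *)
Definition acoef i v : R := 2 * dot (omega i) v / dot (alpha i) (alpha i).

Fact acoef_is_linear i : linear_for *%R (acoef i).
Proof.
by move=> c u v /=; rewrite /acoef dotDr dotZr mulrDr mulrDl mulrCA -!mulrA.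
Qed.
HB.instance Definition _ i := GRing.isLinear.Build R E R _ (acoef i)
  (acoef_is_linear i).

Lemma acoef_alpha i j : acoef i (alpha j) = (i == j)%:R.
Proof.
rewrite /acoef dot_alpha fund_weight_dual; case: eqP => [->|_].
  by have := alpha_norm_gt0 j => /gt_eqF h; rewrite -[RHS]/1 mul1r; field; rewrite h.
by rewrite mul0r mulr0 mul0r.
Qed.

Lemma acoef_sum (A : pred 'I_n) (c : 'I_n -> R) i :
  acoef i (\sum_(j | A j) c j *: alpha j) = if A i then c i else 0.
Proof.
rewrite linear_sum; case: ifP => iA.
  rewrite (bigD1 i) //= big1 => [|j /andP[_ /negPf ji]].
    by rewrite linearZ /= acoef_alpha eqxx mulr1 addr0.
  by rewrite linearZ /= acoef_alpha eq_sym ji mulr0.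
rewrite big1 // => j jA; rewrite linearZ /= acoef_alpha.
by case: eqP => [ji|_]; rewrite ?mulr0 //; rewrite ji jA in iA.
Qed.

Lemma alpha_decomposition v : v = \sum_i acoef i v *: alpha i.
Proof.
apply/eqP; rewrite -subr_eq0; apply/eqP; set x := _ - _.
have ox i : dot (omega i) x = 0.
  have : acoef i x = 0 by rewrite /x linearB /= acoef_sum subrr.
  rewrite /acoef => /eqP; rewrite !mulf_eq0 invr_eq0 pnatr_eq0 /=.
  by rewrite (gt_eqF (alpha_norm_gt0 i)) orbF => /eqP.
apply: dot_eq0; rewrite {1}(omega_decomposition x) dot_suml big1 // => i _.
by rewrite dotZl ox mulr0.
Qed.

Lemma dot_acoef v u :
  dot v u = \sum_i acoef i v * (cpair u (alpha i) * (dot (alpha i) (alpha i) / 2)).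
Proof.
rewrite {1}(alpha_decomposition v) dot_suml; apply: eq_bigr => i _.
by rewrite dotZl dotC dot_alpha.
Qed.

Lemma acoef_refl_alpha i j v :
  acoef j (refl (alpha i) v) = acoef j v - cpair v (alpha i) * (j == i)%:R.
Proof. by rewrite /refl linearB linearZ /= acoef_alpha. Qed.

(** All coefficients of a root have the same sign, so one strictly positive
    coefficient suffices to show that a root is positive. *)
Lemma acoef_root a : a \in Phi ->
  (forall i, exists c : nat, acoef i a = c%:R) \/
  (forall i, exists c : nat, acoef i a = - c%:R).
Proof.
move=> /(simple_root_base)[c [->|->]]; [left|right] => i; exists (c i).
  by rewrite (acoef_sum predT).
by rewrite linearN /= (acoef_sum predT).
Qed.

Lemma pos_rootsP a :
  reflect (a \in Phi /\ forall i, 0 <= acoef i a) (a \in pos_roots S).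
Proof.
rewrite mem_filter; apply: (iffP andP) => [[/asboolP[c ->] ->]|[aR a_ge0]].
  by split=> // i; rewrite (acoef_sum predT) ler0n.
split=> //; apply/asboolP; have [/choice[c ac]|/choice[c ac]] := acoef_root aR.
  exists c; rewrite [LHS]alpha_decomposition.
  by apply: eq_bigr => i _; rewrite ac.
exists (fun=> 0%N); rewrite [LHS]alpha_decomposition.
apply: eq_bigr => i _; have := a_ge0 i; rewrite ac oppr_ge0 => h.
have -> : (c i)%:R = 0 :> R by apply/eqP; rewrite eq_le h ler0n.
by rewrite oppr0.
Qed.

Lemma acoef_pos_nat a i : a \in pos_roots S -> exists c : nat, acoef i a = c%:R.
Proof.
rewrite mem_filter => /andP[/asboolP[c ->] _]; exists (c i).
by rewrite (acoef_sum predT).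
Qed.

Lemma in_parabolicP J a :
  reflect (a \in Phi /\ forall i, i \notin J -> acoef i a = 0)
          (in_parabolic S J a).
Proof.
apply: (iffP andP) => [[aR /asboolP[c ac]]|[aR a0]]; split=> //.
  by move=> i /negPf iJ; rewrite ac acoef_sum iJ.
apply/asboolP.
have /choice[c ac] i : exists z : int, acoef i a = z%:~R.
  case: (acoef_root aR) => h; have [c ->] := h i; first by exists c%:Z.
  by exists (- c%:Z); rewrite mulrNz.
exists c; rewrite [LHS]alpha_decomposition [LHS](bigID (mem J)) /= [X in _ + X]big1.
  by rewrite addr0; apply: eq_bigr => i _; rewrite ac.
by move=> i iJ; rewrite a0 // scale0r.
Qed.

Lemma alpha_pos i : alpha i \in pos_roots S.
Proof.
apply/pos_rootsP; split; first exact: simple_root_in.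
by move=> j; rewrite acoef_alpha ler0n.
Qed.

Lemma root_pos_acoef a i : a \in Phi -> 0 < acoef i a -> a \in pos_roots S.
Proof.
move=> aR ai; apply/pos_rootsP; split=> // j.
have [|] := acoef_root aR; first by move=> /(_ j)[c ->]; rewrite ler0n.
by move=> /(_ i)[c e]; rewrite e oppr_gt0 ltNge ler0n in ai.
Qed.

Lemma pos_root_supp a : a \in pos_roots S -> exists i, 0 < acoef i a.
Proof.
move=> /pos_rootsP[aR a_ge0]; apply: contrapT => /forallNP h.
have /eqP := root_neq0 aR; apply.
rewrite [LHS]alpha_decomposition big1 // => i _.
suff -> : acoef i a = 0 by rewrite scale0r.
by apply/eqP; rewrite eq_le a_ge0 andbT leNgt; apply/negP/h.
Qed.

(** A positive root other than [alpha i] has, by reducedness, a positive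
    coefficient on some other simple root, and the reflection in [alpha i] does
    not change that coefficient. *)
Lemma refl_alpha_pos i a : a \in pos_roots S -> a != alpha i ->
  refl (alpha i) a \in pos_roots S.
Proof.
move=> ap ai; have /pos_rootsP[aR a_ge0] := ap.
have sR : refl (alpha i) a \in Phi by apply: roots_refl; rewrite ?simple_root_in.
have [[j ji aj]|h] := pselect (exists2 j, j != i & 0 < acoef j a).
  apply: (@root_pos_acoef _ j) => //.
  by rewrite acoef_refl_alpha (negPf ji) mulr0 subr0.
have a0 j : j != i -> acoef j a = 0.
  move=> ji; apply/eqP; rewrite eq_le a_ge0 andbT leNgt.
  by apply/negP => aj; apply: h; exists j.
have e : a = acoef i a *: alpha i.
  rewrite {1}[LHS]alpha_decomposition (bigD1 i) //= big1 ?addr0 // => j ji.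
  by rewrite a0 // scale0r.
exfalso; move: aR; rewrite e => /(roots_reduced (simple_root_in S i)) [] h1.
  by move/eqP: ai; apply; rewrite e h1 scale1r.
by have := a_ge0 i; rewrite h1 oppr_ge0 ler10.
Qed.

Lemma refl_alpha i : refl (alpha i) (alpha i) = - alpha i.
Proof.
by rewrite /refl cpair_self ?alpha_neq0 // scaler_nat mulr2n opprD addrA subrr sub0r.
Qed.

Lemma opp_alpha_pos i : - alpha i \notin pos_roots S.
Proof.
apply/negP => /pos_rootsP[_ /(_ i)].
by rewrite linearN /= acoef_alpha eqxx oppr_ge0 ler10.
Qed.

Lemma refl_inj a : a != 0 -> injective (refl a).
Proof. by move=> a0; apply: (can_inj (g := refl a)) => v; rewrite refl_refl. Qed.

Lemma pos_roots_uniq : uniq (pos_roots S).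
Proof. exact/filter_uniq/roots_uniq. Qed.

(** The reflection in [alpha i] permutes the positive roots other than
    [alpha i], and sends [alpha i] to its opposite. *)
Lemma refl_alpha_rho i : refl (alpha i) (rho S) = rho S - alpha i.
Proof.
have ap := alpha_pos i.
rewrite /rho (perm_big _ (perm_to_rem ap)) big_cons /=; set s := rem _ _.
rewrite linearZ linearD linear_sum /= refl_alpha.
have <- : \sum_(a <- s) a = \sum_(a <- s) refl (alpha i) a.
  rewrite -(big_map (refl (alpha i)) predT id); apply: perm_big.
  have us : uniq s by rewrite rem_uniq ?pos_roots_uniq.
  have rs a : a \in s -> refl (alpha i) a \in s.
    rewrite /s !mem_rem_uniq ?pos_roots_uniq // !inE => /andP[ai apos].
    rewrite refl_alpha_pos // andbT; apply: contra_neq ai => e.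
    have := congr1 (refl (alpha i)) e; rewrite refl_refl ?alpha_neq0 // refl_alpha.
    by move=> ea; have := opp_alpha_pos i; rewrite -ea apos.
  apply: uniq_perm => //.
    by rewrite map_inj_uniq //; apply/refl_inj/alpha_neq0.
  move=> a; apply/idP/mapP => [as_|[b bs ->]]; last exact: rs.
  by exists (refl (alpha i) a); rewrite ?rs ?refl_refl ?alpha_neq0.
rewrite !scalerDr addrAC; congr (_ + _).
rewrite scalerN -[X in _ = _ - X]scale1r -scalerBl -scaleNr; congr (_ *: _).
by lra.
Qed.

Lemma cpair_rho i : cpair (rho S) (alpha i) = 1.
Proof.
have := refl_alpha_rho i; rewrite /refl => /(addrI _)/oppr_inj /eqP.
rewrite -subr_eq0 -[X in _ - X]scale1r -scalerBl scaler_eq0 (negPf (alpha_neq0 i)).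
by rewrite orbF subr_eq0 => /eqP.
Qed.

End RootSystem.

(** * The Weyl group *)
Section WeylGroup.
Context {R : realType} {n : nat}.
Variable S : rootSystem R n.
Local Notation E := 'rV[R]_n.
Local Notation Phi := (Defs.roots S).
Local Notation alpha := (simple_root S).
Implicit Types (J : {set 'I_n}) (u v a : E) (w : 'M[R]_n).

Definition srefl i : 'M[R]_n := refl_mx (alpha i).
Definition word (s : seq 'I_n) : 'M[R]_n := \big[mulmx/1%:M]_(i <- s) srefl i.

Lemma sreflK i : srefl i *m srefl i = 1%:M.
Proof. exact/refl_mxK/alpha_neq0. Qed.

Lemma mul_srefl v i : v *m srefl i = v - cpair v (alpha i) *: alpha i.
Proof. exact: mul_refl_mx. Qed.

Lemma word_cons i s : word (i :: s) = srefl i *m word s.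
Proof. by rewrite /word big_cons. Qed.

Lemma word_cat s t : word (s ++ t) = word s *m word t.
Proof.
elim: s => [|i s IH] /=; first by rewrite /word big_nil mul1mx.
by rewrite !word_cons IH mulmxA.
Qed.

Lemma weyl1 J : weyl S J 1%:M.
Proof. by exists [::]; rewrite // big_nil. Qed.

Lemma weyl_mul J w w' : weyl S J w -> weyl S J w' -> weyl S J (w *m w').
Proof.
move=> [s sJ ->] [t tJ ->]; exists (s ++ t); first by rewrite all_cat sJ.
by rewrite -word_cat.
Qed.

Lemma weyl_srefl J i : i \in J -> weyl S J (srefl i).
Proof. by move=> iJ; exists [:: i]; rewrite /= ?iJ // big_cons big_nil mulmx1. Qed.

Lemma weyl_ind J (P : 'M[R]_n -> Prop) : P 1%:M ->
  (forall i w, i \in J -> weyl S J w -> P w -> P (srefl i *m w)) ->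
  forall w, weyl S J w -> P w.
Proof.
move=> P1 PM w [s + ->]; rewrite -/(word s).
elim: s => [_|i s IH /= /andP[iJ sJ]]; first by rewrite /word big_nil.
by rewrite word_cons; apply: PM => //; [exists s|apply: IH].
Qed.

Lemma weyl_sub J w : weyl S J w -> weyl S [set: 'I_n] w.
Proof. by move=> [s _ ->]; exists s => //; apply/allP => i _; rewrite inE. Qed.

(** Matrices act on row vectors on the right, and the Weyl group is orthogonal:
    inverses are transposes. *)
Lemma srefl_tr i : (srefl i)^T = srefl i.
Proof.
have h : srefl i *m (srefl i)^T = 1%:M.
  by apply: orthogonal_mulmx_tr => u v; rewrite !mul_refl_mx dot_refl ?alpha_neq0.
by rewrite -[LHS]mul1mx -(sreflK i) -mulmxA h mulmx1.
Qed.

Lemma weyl_tr J w : weyl S J w -> weyl S J w^T.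
Proof.
elim/weyl_ind => [|i {}w iJ _ wJ]; first by rewrite trmx1; apply: weyl1.
by rewrite trmx_mul srefl_tr; apply: weyl_mul => //; apply: weyl_srefl.
Qed.

Lemma weyl_mulV J w : weyl S J w -> w *m w^T = 1%:M.
Proof.
elim/weyl_ind => [|i {}w iJ _ wJ]; first by rewrite trmx1 mulmx1.
by rewrite trmx_mul srefl_tr mulmxA -(mulmxA (srefl i)) wJ mulmx1 sreflK.
Qed.

Lemma weyl_Vmul J w : weyl S J w -> w^T *m w = 1%:M.
Proof. by move=> /weyl_tr/weyl_mulV; rewrite trmxK. Qed.

Lemma weyl_mulK J w v : weyl S J w -> v *m w *m w^T = v.
Proof. by move=> wJ; rewrite -mulmxA (weyl_mulV wJ) mulmx1. Qed.

Lemma dot_mulmx_tr w u v : dot (u *m w^T) v = dot u (v *m w).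
Proof. by rewrite /dot trmx_mul mulmxA. Qed.

Lemma dot_weyl J w u v : weyl S J w -> dot (u *m w) (v *m w) = dot u v.
Proof. by move=> wJ; rewrite /dot trmx_mul mulmxA (weyl_mulK _ wJ). Qed.

Lemma weyl_root J w a : weyl S J w -> a \in Phi -> a *m w \in Phi.
Proof.
move=> wJ; elim/weyl_ind : wJ a => [|i {}w _ _ IH] a aR; first by rewrite mulmx1.
rewrite mulmxA; apply: IH; rewrite mul_refl_mx.
by apply: roots_refl => //; apply: simple_root_in.
Qed.

Lemma weyl_acoef J w v j : weyl S J w -> j \notin J ->
  acoef S j (v *m w) = acoef S j v.
Proof.
move=> wJ jJ; elim/weyl_ind : wJ v => [|i {}w iJ _ IH] v; first by rewrite mulmx1.
rewrite mulmxA IH mul_refl_mx acoef_refl_alpha; case: eqP => [ji|]; last first.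
  by rewrite mulr0 subr0.
by rewrite ji iJ in jJ.
Qed.

Lemma weyl_fix J w v : weyl S J w -> (forall i, i \in J -> cpair v (alpha i) = 0) ->
  v *m w = v.
Proof.
move=> + v0; elim/weyl_ind => [|i {}w iJ _ IH]; first by rewrite mulmx1.
by rewrite mulmxA mul_srefl v0 // scale0r subr0.
Qed.

(** An element of the Weyl group is determined by the images of the simple
    roots, which are roots. *)
Lemma finite_weyl J : finite_set (weyl S J).
Proof.
pose A : 'M[R]_n := \matrix_i alpha i.
have Aw w : A *m w = \matrix_i (alpha i *m w).
  by apply/row_matrixP => i; rewrite row_mul !rowK.
have Au : A \in unitmx.
  (* B expresses the canonical basis in terms of the simple roots. *)
  pose B : 'M[R]_n := \matrix_(i, j) acoef S j (delta_mx 0 i).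
  suff : B *m A = 1%:M by move/mulmx1_unit => [].
  apply: mulmx_rV_inj => v; rewrite mulmx1; apply/rowP => k.
  rewrite mulmxA mulmx_sum_row.
  rewrite [in RHS](alpha_decomposition S v); congr (fun_of_matrix _ _ _).
  apply: eq_bigr => j _; rewrite rowK; congr (_ *: _).
  rewrite mxE {2}(row_sum_delta v) linear_sum; apply: eq_bigr => i _.
  by rewrite mxE linearZ.
pose g (f : {ffun 'I_n -> 'I_(size Phi)}) : 'M[R]_n :=
  invmx A *m \matrix_i Phi`_(f i).
apply: (@sub_finite_set _ _ (g @` [set: _])); last exact/finite_image/finite_finset.
move=> w wJ /=.
have wR i : (index (alpha i *m w) Phi < size Phi)%N.
  by rewrite index_mem (weyl_root wJ) ?simple_root_in.
exists [ffun i => Ordinal (wR i)] => //; rewrite /g.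
rewrite -[RHS](mulKmx Au) Aw; congr (_ *m _); apply/row_matrixP => i.
by rewrite !rowK ffunE nth_index // (weyl_root wJ) ?simple_root_in.
Qed.

Lemma sign_char1 : sign_char (1%:M : 'M[R]_n) = 1.
Proof. by rewrite /sign_char det1 sgz1. Qed.

Lemma sign_char_mul w w' : sign_char (w *m w') = sign_char w * sign_char w'.
Proof. by rewrite /sign_char det_mulmx sgzM intrM. Qed.

Lemma sign_char_srefl i : sign_char (srefl i) = -1.
Proof. by rewrite /sign_char det_refl_mx ?alpha_neq0 // sgzN sgz1 mulrNz. Qed.

Lemma sign_char_sqr J w : weyl S J w -> sign_char w * sign_char w = 1.
Proof.
move=> wJ; have := sign_char_mul w w^T; rewrite (weyl_mulV wJ) sign_char1.
suff -> : sign_char w^T = sign_char w by move=> <-.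
by rewrite /sign_char det_tr.
Qed.

(** Along a word that makes a positive root negative, look at the letter where
    the sign changes: only the simple root of that letter becomes negative under
    its reflection. *)
Lemma word_descent s a : a \in pos_roots S -> a *m word s \notin pos_roots S ->
  exists t1 j t2, s = t1 ++ j :: t2 /\ a *m word t1 = alpha j.
Proof.
elim: s a => [|j s IH] a ap; first by rewrite /word big_nil mulmx1 ap.
rewrite word_cons mulmxA mul_refl_mx => nap; have [aj|aj] := eqVneq a (alpha j).
  by exists [::], j, s; rewrite /word big_nil mulmx1.
have [t1 [k [t2 [-> e]]]] := IH _ (refl_alpha_pos ap aj) nap.
by exists (j :: t1), k, t2; rewrite word_cons mulmxA mul_refl_mx.
Qed.

Lemma weyl_word s : weyl S [set: 'I_n] (word s).
Proof. by exists s => //; apply/allP => i _; rewrite inE. Qed.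

(** Deletion: if the word [s] sends [alpha i] to the simple root [alpha j] just
    before a letter [j], conjugation turns the initial reflection [i] into that
    [j], and the two letters cancel. *)
Lemma word_deletion i s : alpha i *m word (i :: s) \in pos_roots S ->
  exists2 t, word t = word (i :: s) & (size t < size (i :: s))%N.
Proof.
rewrite word_cons mulmxA mul_refl_mx refl_alpha mulNmx => h.
have nap : alpha i *m word s \notin pos_roots S.
  apply/negP => /pos_root_supp[j hj]; have /pos_rootsP[_ /(_ j)] := h.
  by rewrite linearN /= oppr_ge0 leNgt hj.
have [t1 [j [t2 [-> e]]]] := word_descent (alpha_pos S i) nap.
exists (t1 ++ t2); last by rewrite /= !size_cat /= addnS ltnW.
rewrite !word_cat word_cons mulmxA.
rewrite /srefl refl_mx_conj ?(weyl_mulV (weyl_word t1)) // e -/(srefl j) -!mulmxA.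
by rewrite (mulmxA (srefl j)) sreflK mul1mx.
Qed.

Lemma weyl_pos_id w : weyl S [set: 'I_n] w ->
  (forall i, alpha i *m w \in pos_roots S) -> w = 1%:M.
Proof.
move=> [s _ ->]; rewrite -/(word s); have [m] := ubnP (size s).
elim: m s => // m IH [|i s] sm pos; first by rewrite /word big_nil.
have [t e st] := word_deletion (pos i); rewrite -e; apply: IH.
  exact: leq_trans st _.
by move=> j; rewrite e.
Qed.

Lemma root_pos_dot a v : a \in Phi ->
  (forall j, 0 <= cpair v (alpha j)) -> 0 < dot a v ->
  a \in pos_roots S.
Proof.
move=> aR vpos av; have [h|h] := acoef_root aR.
  by apply/pos_rootsP; split=> // i; have [c ->] := h i; rewrite ler0n.
suff : dot a v <= 0 by rewrite leNgt av.
rewrite (dot_acoef S) sumr_le0 // => i _.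
have [c ->] := h i; rewrite mulNr oppr_le0 mulr_ge0 // mulr_ge0 //.
by rewrite divr_ge0 // dot_ge0.
Qed.

(** The vector [v] is only required to be dominant on the support of [a]: this
    allows [a] to lie in the parabolic subsystem and [v] to be dominant for that
    subsystem. *)
Lemma root_pos_dot_strict a v : a \in Phi ->
  (forall j, 0 < cpair v (alpha j) \/ acoef S j a = 0) -> 0 <= dot a v ->
  a \in pos_roots S.
Proof.
move=> aR vpos av; apply: contrapT => /negP an.
have [h|h] := acoef_root aR.
  by case/pos_rootsP: an; split=> // i; have [c ->] := h i; rewrite ler0n.
have [i ai] : exists i, acoef S i a < 0.
  apply: contrapT => /forallNP h'; case/pos_rootsP: an; split=> // i.
  by rewrite leNgt; apply/negP/h'.
suff : dot a v < 0 by rewrite ltNge av.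
have kp j : 0 < cpair v (alpha j) ->
    0 < cpair v (alpha j) * (dot (alpha j) (alpha j) / 2).
  by move=> vj; rewrite mulr_gt0 // divr_gt0 // alpha_norm_gt0.
rewrite (dot_acoef S) (bigD1 i) //= ltr_wnDr //.
  rewrite sumr_le0 // => j _; have [hv|->] := vpos j; last by rewrite mul0r.
  by have [c ->] := h j; rewrite mulNr oppr_le0 mulr_ge0 // ltW // kp.
have [hv|e] := vpos i; last by rewrite e ltxx in ai.
by rewrite nmulr_rlt0 // kp.
Qed.

(** The inverse of [w] keeps every simple root positive.  For i in J its image
    is in the span of the alpha_j, j in J, and has a nonnegative scalar product
    with the regular vector [v]; for i outside J the coefficient of [alpha i]
    is unchanged. *)
Lemma weyl_regular_id J w v : weyl S J w ->
  (forall i, i \in J -> 0 < cpair v (alpha i)) ->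
  (forall i, i \in J -> 0 <= cpair (v *m w) (alpha i)) -> w = 1%:M.
Proof.
move=> wJ vpos vwpos; have wtJ := weyl_tr wJ.
rewrite -[w]trmxK; suff -> : w^T = 1%:M by rewrite trmx1.
apply: (weyl_pos_id (weyl_sub wtJ)) => i.
have aR := weyl_root wtJ (simple_root_in S i).
have [iJ|iJ] := boolP (i \in J); last first.
  apply: (@root_pos_acoef _ _ _ _ i) => //.
  by rewrite (weyl_acoef _ wtJ) // acoef_alpha eqxx.
apply: (@root_pos_dot_strict _ v) => //.
  move=> j; have [jJ|jJ] := boolP (j \in J); [left; exact: vpos|right].
  rewrite (weyl_acoef _ wtJ) // acoef_alpha; case: eqP => // ji.
  by rewrite ji iJ in jJ.
rewrite dot_mulmx_tr dotC -cpair_ge0 ?alpha_neq0 //.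
exact: vwpos.
Qed.

Lemma weyl_argmax J (f : 'M[R]_n -> R) :
  exists2 u, weyl S J u & forall w, weyl S J w -> f w <= f u.
Proof.
have argmax (s : seq 'M[R]_n) : s != [::] ->
    exists2 x, x \in s & forall y, y \in s -> f y <= f x.
  elim: s => // x s IH _; case: (eqVneq s [::]) => [->|/IH[y ys ymax]].
    by exists x; rewrite ?mem_seq1 // => z; rewrite mem_seq1 => /eqP ->.
  case: (lerP (f x) (f y)) => xy; [exists y|exists x];
    rewrite ?inE ?eqxx ?ys ?orbT //.
    by move=> z; rewrite inE => /orP[/eqP -> //|/ymax].
  move=> z; rewrite inE => /orP[/eqP -> //|/ymax zy]; exact: le_trans zy (ltW xy).
have /finite_seqP[s Ws] := finite_weyl J.
have s0 : s != [::] by apply/eqP => s0; have := weyl1 J; rewrite Ws s0.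
have [u us umax] := argmax s s0.
by exists u; rewrite Ws // => w /umax.
Qed.

(** The point of the orbit with the largest scalar product with [rho] is
    dominant, since reflecting it in a root with a negative pairing would
    increase this scalar product. *)
Lemma weyl_dominant J v : exists2 u, weyl S J u &
  forall i, i \in J -> 0 <= cpair (v *m u) (alpha i).
Proof.
have [u uJ umax] := weyl_argmax J (fun w => dot (v *m w) (rho S)).
exists u => // i iJ; have := umax _ (weyl_mul uJ (weyl_srefl iJ)).
rewrite mulmxA mul_srefl dotDl dotNl dotZl gerDl oppr_le0 pmulr_lge0 //.
by rewrite dotC dot_alpha cpair_rho mul1r divr_gt0 // alpha_norm_gt0.
Qed.

(** Multiply [w] by an element [u] of the parabolic subgroup making the image of
    [rho] dominant for J.  The product x still fixes [rho_dia], and its inverse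
    keeps every simple root positive, as one sees by pairing with [rho] for i in
    J and with [rho_dia] for i outside J; hence x = 1. *)
Lemma weyl_stabilizer J w : weyl S [set: 'I_n] w ->
  dia S J (rho S) *m w = dia S J (rho S) -> weyl S J w.
Proof.
move=> wW wfix; have [u uJ udom] := weyl_dominant J (rho S *m w).
have uW := weyl_sub uJ; have xW := weyl_mul wW uW; have xtW := weyl_tr xW.
have xfix : dia S J (rho S) *m (w *m u) = dia S J (rho S).
  rewrite mulmxA wfix (weyl_fix uJ) // => i iJ.
  by rewrite cpair_dia iJ.
suff x1 : (w *m u)^T = 1%:M.
  have -> : w = u^T.
    rewrite -[w]mulmx1 -(weyl_mulV uJ) mulmxA.
    by rewrite -[w *m u]trmxK x1 trmx1 mul1mx.
  exact: weyl_tr.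
apply: weyl_pos_id => // i; have aR := weyl_root xtW (simple_root_in S i).
have [iJ|iJ] := boolP (i \in J).
  apply: (@root_pos_dot_strict _ (rho S)) => //.
    by move=> j; left; rewrite cpair_rho.
  by rewrite dot_mulmx_tr dotC -cpair_ge0 ?alpha_neq0 // mulmxA udom.
apply: (@root_pos_dot _ (dia S J (rho S))) => //.
  by move=> j; rewrite cpair_dia; case: ifP => // _; rewrite cpair_rho.
rewrite dot_mulmx_tr xfix dotC -cpair_gt0 ?alpha_neq0 //.
by rewrite cpair_dia (negPf iJ) cpair_rho.
Qed.

End WeylGroup.

(** * Products of geometric series *)
Section Series.
Context {R : realType} {n : nat}.
Local Notation E := 'rV[R]_n.
Implicit Types (f g F G : E -> Zpq) (a b v : E) (s : seq E) (c : Zpq) (D : set E).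

Lemma fsum_neq0 (T : choiceType) (A : set T) (F : T -> Zpq) :
  \sum_(x \in A) F x != 0 -> exists2 x, A x & F x != 0.
Proof. exact: (@fsbigN1 _ _ _ unit T A (fun=> F) tt). Qed.

Lemma geometric_supp c a b : geometric c a b != 0 -> exists m, b = a *+ m.
Proof. by move=> /fsum_neq0[m /= <- _]; exists m. Qed.

Lemma mulrn_vec_inj a : a != 0 -> injective (fun m => a *+ m).
Proof.
move=> a0 k m /= /eqP; rewrite -subr_eq0 -!scaler_nat -scalerBl scaler_eq0.
by rewrite (negPf a0) orbF subr_eq0 eqr_nat => /eqP.
Qed.

Lemma geometric_mul c a m : a != 0 -> geometric c a (a *+ m) = c ^+ m.
Proof.
move=> a0; rewrite /geometric (_ : [set _ | _] = [set m]) ?fsbig_set1 //.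
by apply/seteqP; split=> [k /= | k -> //]; exact: mulrn_vec_inj.
Qed.

Definition addmonoid D := D 0 /\ forall u v, D u -> D v -> D (u + v).

Lemma addmonoidMn D a m : addmonoid D -> D a -> D (a *+ m).
Proof. by move=> [D0 DD] Da; elim: m => // m IH; rewrite mulrS; apply: DD. Qed.

Lemma geometric_prod_cons c a s :
  geometric_prod c (a :: s) = series_mul (geometric c a) (geometric_prod c s).
Proof. by rewrite /geometric_prod big_cons. Qed.

Lemma series_mul_supp D f g b : addmonoid D ->
  (forall x, f x != 0 -> D x) -> (forall x, g x != 0 -> D x) ->
  series_mul f g b != 0 -> D b.
Proof.
move=> [_ DD] fD gD /fsum_neq0[x _].
rewrite mulf_eq0 negb_or => /andP[/fD Dx /gD Dy].
by rewrite -(subrK x b) addrC; apply: DD.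
Qed.

Lemma geometric_prod_supp D c s b : addmonoid D -> (forall a, a \in s -> D a) ->
  geometric_prod c s b != 0 -> D b.
Proof.
move=> DM; elim: s b => [|a s IH] b sD.
  rewrite /geometric_prod big_nil /series1.
  case: (b =P 0) => [-> _|_]; first by case: DM.
  by rewrite eqxx.
rewrite geometric_prod_cons; apply: series_mul_supp => // x.
  move=> /geometric_supp[m ->]; apply: addmonoidMn => //.
  by apply: sD; rewrite mem_head.
by apply: IH => y ys; apply: sD; rewrite inE ys orbT.
Qed.

(** An additive form [h], positive on the exponents of the series, replaces
    completeness arguments: every coefficient of a product is a finite sum, and
    identities can be proved by descending along an exponent until [h] becomes
    negative. *)
Section HalfSpace.
Variable h : {additive E -> R}.

Definition half_supported F := forall b, h b < 0 -> F b = 0.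

(** Multiplication by 1 - c e^a. *)
Definition one_sub_shift c a F : E -> Zpq := fun b => F b - c * F (b - a).

Lemma eventually_outside a b : 0 < h a ->
  exists N : nat, forall m, (N <= m)%N -> h (b - a *+ m) < 0.
Proof.
move=> ha; exists (Num.bound `|h b / h a|) => m Nm.
rewrite raddfB raddfMn /= subr_lt0 -mulr_natl -ltr_pdivrMr //.
apply: le_lt_trans (ler_norm _) _; apply: lt_le_trans (archi_boundP _) _ => //.
by rewrite ler_nat.
Qed.

Lemma geometric_mulE c a G b : 0 < h a -> half_supported G ->
  forall N, (forall m, (N <= m)%N -> h (b - a *+ m) < 0) ->
  series_mul (geometric c a) G b = \sum_(m < N) c ^+ m * G (b - a *+ m).
Proof.
move=> ha uG N hN.
have a0 : a != 0 by apply: contraTneq ha => ->; rewrite raddf0 ltxx.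
rewrite /series_mul.
rewrite -(@fsbig_widen _ _ _ _ ((fun m => a *+ m) @` `I_N)) //; last first.
  move=> x [_ nx]; apply: contrapT => /eqP; rewrite mulf_eq0 negb_or => /andP[gx Gx].
  have [m e] := geometric_supp gx; apply: nx; exists m => //=.
  rewrite ltnNge; apply: contraNN Gx => /hN; rewrite -e => /uG ->; exact: eqxx.
rewrite fsbig_image; last by move=> ? ? _ _; exact: mulrn_vec_inj.
rewrite -(fsbig_ord _ N (fun m => geometric c a (a *+ m) * G (b - a *+ m))).
by apply: eq_bigr => m _; rewrite geometric_mul.
Qed.

Lemma half_supported_geometric_mul c a G : 0 < h a -> half_supported G ->
  half_supported (series_mul (geometric c a) G).
Proof.
move=> ha uG b hb; rewrite (geometric_mulE _ ha uG (N := 0)) ?big_ord0 // => m _.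
by rewrite raddfB raddfMn /= subr_lt0 (lt_le_trans hb) // mulrn_wge0 // ltW.
Qed.

Lemma shift_geometric_mul c a G : 0 < h a -> half_supported G ->
  one_sub_shift c a (series_mul (geometric c a) G) =1 G.
Proof.
move=> ha uG b; have [N hN] := eventually_outside b ha.
have hN1 m : (N <= m)%N -> h (b - a - a *+ m) < 0.
  by move=> Nm; rewrite -addrA -opprD -mulrS hN // ltnW.
rewrite /one_sub_shift (geometric_mulE _ ha uG (N := N.+1)); last first.
  by move=> m /ltnW/hN.
(* The sum for b - a has one term less: multiplied by c, it is the sum for b
   without its first term. *)
rewrite (geometric_mulE _ ha uG hN1) big_ord_recl expr0 mul1r mulr0n subr0.
rewrite mulr_sumr -addrA [X in _ + X](_ : _ = 0) ?addr0 //.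
apply/eqP; rewrite subr_eq0; apply/eqP; apply: eq_bigr => m _.
by rewrite /= /bump /= add1n exprS mulrA mulrS opprD addrA.
Qed.

(** The value at b is determined by that at b - a, hence by those at b - m a,
    which vanish for large m. *)
Lemma one_sub_shift_inj c a F G : 0 < h a -> half_supported F -> half_supported G ->
  one_sub_shift c a F =1 one_sub_shift c a G -> F =1 G.
Proof.
move=> ha uF uG FG b; have [N hN] := eventually_outside b ha.
elim: N b hN => [|N IH] b hN.
  have hb : h b < 0 by have := hN 0 (leqnn _); rewrite mulr0n subr0.
  by rewrite uF // uG.
have e : F (b - a) = G (b - a).
  by apply: IH => m Nm; rewrite -addrA -opprD -mulrS hN.
by have := FG b; rewrite /one_sub_shift e => /addIr.
Qed.

Lemma one_sub_shiftC c a b F :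
  one_sub_shift c a (one_sub_shift c b F) =1
  one_sub_shift c b (one_sub_shift c a F).
Proof. by move=> x; rewrite /one_sub_shift [x - b - a]addrAC; ring. Qed.

Lemma half_supported_one_sub_shift c a F : 0 < h a ->
  half_supported F -> half_supported (one_sub_shift c a F).
Proof.
move=> ha uF b hb; rewrite /one_sub_shift !uF ?mulr0 ?subr0 //.
by rewrite raddfB subr_lt0 (lt_trans hb).
Qed.

Definition hpos s := forall a, a \in s -> 0 < h a.

Lemma half_supported_geometric_prod c s :
  hpos s -> half_supported (geometric_prod c s).
Proof.
elim: s => [|a s IH] sp b hb.
  rewrite /geometric_prod big_nil /series1; case: (b =P 0) => // b0.
  by rewrite b0 raddf0 ltxx in hb.
rewrite geometric_prod_cons half_supported_geometric_mul //.
  by apply: sp; rewrite mem_head.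
by apply: IH => x xs; apply: sp; rewrite inE xs orbT.
Qed.

Lemma shift_geometric_prod c a s : hpos (a :: s) ->
  one_sub_shift c a (geometric_prod c (a :: s)) =1 geometric_prod c s.
Proof.
move=> sp b; rewrite geometric_prod_cons shift_geometric_mul //.
  by apply: sp; rewrite mem_head.
by apply: half_supported_geometric_prod => x xs; apply: sp; rewrite inE xs orbT.
Qed.

(** Applying 1 - c e^a and 1 - c e^b to either side leaves the product
    over [s]. *)
Lemma geometric_prod_swap c a b s : hpos [:: a, b & s] ->
  geometric_prod c [:: a, b & s] =1 geometric_prod c [:: b, a & s].
Proof.
move=> sp; have sp' : hpos [:: b, a & s].
  by move=> x; rewrite !inE orbCA -!in_cons => /sp.
have ha : 0 < h a by apply: sp; rewrite !inE eqxx.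
have hb : 0 < h b by apply: sp; rewrite !inE eqxx orbT.
have spa : hpos (a :: s) by move=> x xs; apply: sp'; rewrite inE xs orbT.
have spb : hpos (b :: s) by move=> x xs; apply: sp; rewrite inE xs orbT.
apply: (one_sub_shift_inj (c := c) ha); try exact: half_supported_geometric_prod.
apply: (one_sub_shift_inj (c := c) hb);
  try (apply: half_supported_one_sub_shift => //;
       exact: half_supported_geometric_prod).
move=> x; rewrite [RHS]one_sub_shiftC.
have e1 : one_sub_shift c b
    (one_sub_shift c a (geometric_prod c [:: a, b & s])) x = geometric_prod c s x.
  rewrite -(shift_geometric_prod c spb x) /one_sub_shift.
  by rewrite -!(shift_geometric_prod c sp).
have e2 : one_sub_shift c a
    (one_sub_shift c b (geometric_prod c [:: b, a & s])) x = geometric_prod c s x.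
  rewrite -(shift_geometric_prod c spa x) /one_sub_shift.
  by rewrite -!(shift_geometric_prod c sp').
by rewrite e1 e2.
Qed.

Lemma geometric_prod_perm c s t : hpos s -> perm_eq s t ->
  geometric_prod c s = geometric_prod c t.
Proof.
have mid s1 a s2 : hpos (a :: s1 ++ s2) ->
    geometric_prod c (s1 ++ a :: s2) = geometric_prod c (a :: s1 ++ s2).
  elim: s1 => [//|x s1 IH] sp /=.
  rewrite geometric_prod_cons IH => [|y ys]; last first.
    by apply: sp; move: ys; rewrite !inE => /orP[->//|->]; rewrite !orbT.
  rewrite -geometric_prod_cons; apply/funext; apply: geometric_prod_swap.
  by move=> y; rewrite !inE orbCA -!in_cons => /sp.
elim: s t => [|a s IH] t sp; first by rewrite perm_sym => /perm_nilP ->.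
move=> st; have at_ : a \in t by rewrite -(perm_mem st) mem_head.
case/splitPr: at_ st => t1 t2 st.
have st' : perm_eq s (t1 ++ t2).
  by rewrite -(perm_cons a) (perm_trans st) // (perm_catCA t1 [:: a]).
rewrite mid; last first.
  move=> x xs; apply: sp; move: xs.
  by rewrite (perm_mem st) inE !mem_cat inE orbCA.
rewrite !geometric_prod_cons (IH _ _ st') // => x xs.
by apply: sp; rewrite inE xs orbT.
Qed.

End HalfSpace.

(** Stated for involutions, where the change of variables is its own inverse;
    this covers the simple reflections. *)
Lemma geometric_prod_invol (M : 'M[R]_n) c s b : M *m M = 1%:M ->
  geometric_prod c s (b *m M) = geometric_prod c [seq a *m M | a <- s] b.
Proof.
move=> MM; pose g (v : E) : E := v *m M.
have MK : involutive g by move=> v; rewrite /g -mulmxA MM mulmx1.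
have Mn (a : E) m : (a *+ m) *m M = (a *m M) *+ m by rewrite -!scaler_nat scalemxAl.
elim: s b => [|a s IH] b.
  rewrite /geometric_prod !big_nil /series1; congr (nat_of_bool _)%:R.
  by apply/eqP/eqP => [e|->]; rewrite ?mul0mx // -[b]MK /g e mul0mx.
rewrite /= !geometric_prod_cons /series_mul.
rewrite (@reindex_fsbigT _ _ _ E E g _ (inv_bij MK)); apply: eq_fsbigr => x _ /=.
rewrite -mulmxBl IH; congr (_ * _); apply: eq_fsbigl.
apply/seteqP; split=> m /= e; last by rewrite /g -e -Mn -mulmxA MM mulmx1.
by rewrite -Mn e; exact: MK.
Qed.

End Series.

(** * The cone spanned by the simple roots *)
Section Cone.
Context {R : realType} {n : nat}.
Variable S : rootSystem R n.
Local Notation E := 'rV[R]_n.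
Local Notation Phi := (Defs.roots S).
Local Notation alpha := (simple_root S).
Local Notation acoef := (acoef S).
Implicit Types (J : {set 'I_n}) (u v a x : E) (w : 'M[R]_n).

Definition root_cone : set E := [set v | forall i, exists c : nat, acoef i v = c%:R].

Lemma root_cone_monoid : addmonoid root_cone.
Proof.
split=> [i|u v hu hv i]; first by exists 0%N; rewrite linear0.
have [c uc] := hu i; have [d vd] := hv i.
by exists (c + d)%N; rewrite linearD /= uc vd natrD.
Qed.

Lemma pos_root_cone a : a \in pos_roots S -> root_cone a.
Proof. by move=> ap i; exact: acoef_pos_nat. Qed.

(** The half space in which all partition functions are supported. *)
Definition height v : R := \sum_i acoef i v.

Fact height_is_linear : linear_for *%R height.
Proof.
move=> c u v /=; rewrite /height mulr_sumr -big_split; apply: eq_bigr => i _ /=.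
exact: linearP.
Qed.
HB.instance Definition _ := GRing.isLinear.Build R E R _ height height_is_linear.

Lemma height_pos_root a : a \in pos_roots S -> 0 < height a.
Proof.
move=> ap; have [i ai] := pos_root_supp ap; have /pos_rootsP[_ age0] := ap.
by rewrite /height (bigD1 i) //= ltr_wpDr // sumr_ge0.
Qed.

Lemma root_cone_dot x v : root_cone x -> (forall i, 0 <= cpair v (alpha i)) ->
  0 <= dot x v.
Proof.
move=> xc vd; rewrite (dot_acoef S) sumr_ge0 // => i _.
have [c ->] := xc i; by rewrite mulr_ge0 // mulr_ge0 // divr_ge0 // dot_ge0.
Qed.

(** The coefficients of x - v on the simple roots are natural numbers bounded by
    those of u - v. *)
Lemma finite_root_cone_interval u v :
  finite_set [set x | root_cone (u - x) /\ root_cone (x - v)].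
Proof.
pose N := (\sum_i Num.bound `|acoef i (u - v)|)%N.
pose g (f : {ffun 'I_n -> 'I_N.+1}) : E := v + \sum_i (f i)%:R *: alpha i.
apply: (@sub_finite_set _ _ (g @` [set: _])); last exact/finite_image/finite_finset.
move=> x [xu /choice[c xv]].
have cN i : (c i < N.+1)%N.
  have [d xd] := xu i.
  have le1 : (c i)%:R <= acoef i (u - v) :> R.
    by rewrite -(subrK x u) -addrA linearD /= xd xv lerDr.
  have lt2 : acoef i (u - v) < (Num.bound `|acoef i (u - v)|)%:R.
    exact: le_lt_trans (ler_norm _) (archi_boundP (normr_ge0 _)).
  have := le_lt_trans le1 lt2; rewrite ltr_nat => /leq_trans -> //.
  by rewrite leqW // /N (bigD1 i) //= leq_addr.
exists [ffun i => Ordinal (cN i)] => //; rewrite /g.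
rewrite -[RHS](subrK v) addrC; congr (_ + _).
rewrite [RHS](alpha_decomposition S); apply: eq_bigr => i _.
by rewrite ffunE xv.
Qed.

Section Supports.
Variable J : {set 'I_n}.

Lemma part_hat_supp b : part_hat S J b != 0 -> root_cone b.
Proof.
apply: geometric_prod_supp => [|a]; first exact: root_cone_monoid.
by rewrite mem_filter => /andP[_]; exact: pos_root_cone.
Qed.

Lemma part_bar_supp b : part_bar S J b != 0 -> root_cone b.
Proof.
apply: geometric_prod_supp => [|a]; first exact: root_cone_monoid.
by rewrite mem_filter => /andP[_]; exact: pos_root_cone.
Qed.

Lemma part_pq_supp b : part_pq S J b != 0 -> root_cone b.
Proof.
exact: series_mul_supp root_cone_monoid part_hat_supp part_bar_supp.
Qed.

(** For i in J the reflection changes only the coefficient of [alpha i], so it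
    preserves the positive roots having a nonzero coefficient outside J. *)
Lemma part_hat_srefl i b : i \in J -> part_hat S J (b *m srefl S i) = part_hat S J b.
Proof.
move=> iJ; rewrite /part_hat geometric_prod_invol ?sreflK //; set s := filter _ _.
have us : uniq s by exact/filter_uniq/pos_roots_uniq.
have inv (a : E) : a *m srefl S i *m srefl S i = a by rewrite -mulmxA sreflK mulmx1.
have ss a : a \in s -> a *m srefl S i \in s.
  rewrite mem_filter => /andP[anp ap]; rewrite mem_filter.
  have /pos_rootsP[aR age0] := ap.
  have saR := weyl_root (weyl_srefl S iJ) aR.
  have [j jJ aj] : exists2 j, j \notin J & acoef j a != 0.
    apply: contrapT => /forall2NP h; move/negP: anp; apply; apply/in_parabolicP.
    by split=> // j jJ; case: (h j) => // /negP; rewrite negbK => /eqP.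
  have saj : acoef j (a *m srefl S i) = acoef j a.
    by rewrite (weyl_acoef _ (weyl_srefl S iJ)).
  apply/andP; split.
    by apply/negP => /in_parabolicP[_ /(_ _ jJ)] /eqP; rewrite saj (negPf aj).
  by apply: (@root_pos_acoef _ _ _ _ j) => //; rewrite saj lt0r aj age0.
congr (_ b); apply: (@geometric_prod_perm _ _ height).
  move=> a /mapP[x /ss xs ->]; apply: height_pos_root.
  by move: xs; rewrite mem_filter => /andP[].
apply: uniq_perm => //.
  by rewrite map_inj_uniq // => x y /(congr1 (mulmx^~ (srefl S i))); rewrite !inv.
move=> a; apply/mapP/idP => [[x xs ->]|as_]; first exact: ss.
by exists (a *m srefl S i); [exact: ss|rewrite inv].
Qed.

End Supports.

Lemma srefl_weights i v : (forall j, cpair v (alpha j) \is a Num.int) ->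
  forall j, cpair (v *m srefl S i) (alpha j) \is a Num.int.
Proof.
move=> vi j; rewrite mul_srefl cpairDl cpairNl cpairZl rpredB // rpredM //.
by apply: roots_int; apply: simple_root_in.
Qed.

Lemma weyl_weights J w v : weyl S J w ->
  (forall j, cpair v (alpha j) \is a Num.int) ->
  forall j, cpair (v *m w) (alpha j) \is a Num.int.
Proof.
move=> wJ; elim/(@weyl_ind R n S J) : wJ v => [|i {}w _ _ IH] v vi.
  by rewrite mulmx1.
by rewrite mulmxA; apply/IH/srefl_weights.
Qed.

Lemma weightsP v : weights S v <-> forall j, cpair v (alpha j) \is a Num.int.
Proof.
split=> [[c ->] j|h].
  by rewrite (cpair_sum_omega S predT); exact: intr_int.
have /choice[c vc] j : exists z : int, cpair v (alpha j) = z%:~R by exact/intrP.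
exists c; rewrite [LHS](omega_decomposition S).
by apply: eq_bigr => i _; rewrite vc.
Qed.

Lemma root_cone_weights v : root_cone v -> forall j, cpair v (alpha j) \is a Num.int.
Proof.
move=> vc j; rewrite (alpha_decomposition S v) cpair_suml rpred_sum // => i _.
have [c ->] := vc i; rewrite cpairZl rpredM ?rpred_nat //.
by apply: roots_int; apply: simple_root_in.
Qed.

End Cone.

(** * Stabilization of alternating sums *)
Section Stabilization.
Context {R : realType} {n : nat}.
Variables (S : rootSystem R n) (J : {set 'I_n}).
Local Notation E := 'rV[R]_n.
Local Notation alpha := (simple_root S).
Local Notation rho := (rho S).
Local Notation rho_bar := (bar S J rho).
Local Notation rho_dia := (dia S J rho).
Implicit Types (v x nu mu : E) (u w : 'M[R]_n).

Lemma cpair_rho_dia_ge0 i : 0 <= cpair rho_dia (alpha i).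
Proof. by rewrite cpair_dia; case: ifP => // _; rewrite cpair_rho. Qed.

Lemma rho_dia_fix w : weyl S J w -> rho_dia *m w = rho_dia.
Proof. by move=> wJ; apply: (weyl_fix wJ) => i iJ; rewrite cpair_dia iJ. Qed.

(** For an isometry w, <w d - d, d> = - |w d - d|^2 / 2. *)
Lemma rho_dia_descent w : weyl S [set: 'I_n] w -> ~ weyl S J w ->
  dot (rho_dia *m w - rho_dia) rho_dia < 0.
Proof.
move=> wW wJ; set d := rho_dia.
have : 0 < dot (d *m w - d) (d *m w - d).
  apply: dot_gt0; rewrite subr_eq0; apply: contra_notN wJ => /eqP.
  exact: weyl_stabilizer.
rewrite !(dotDl, dotDr, dotNl, dotNr) (dot_weyl _ _ wW) (dotC d (d *m w)).
by move: (dot (d *m w) d) (dot d d) => p q; lra.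
Qed.

Lemma cone_escape nu mu w : weyl S [set: 'I_n] w -> ~ weyl S J w ->
  exists k0 : nat, forall k, (k0 <= k)%N ->
    ~ root_cone S ((nu + rho_dia *+ k + rho) *m w - (mu + rho_dia *+ k) - rho).
Proof.
move=> wW wJ; have := rho_dia_descent wW wJ; set d := rho_dia => d0.
set X := (nu + rho) *m w - mu - rho; set e := dot _ _ in d0.
exists (Num.bound `|dot X d / - e|) => k k0 /root_cone_dot /(_ cpair_rho_dia_ge0).
rewrite -/d (_ : _ - _ - _ = X + (d *m w - d) *+ k); last first.
  have -> : (d *m w - d) *+ k = (d *+ k) *m w - d *+ k.
    by rewrite mulrnBl -!scaler_nat scalemxAl.
  rewrite /X !mulmxDl; move: (nu *m w) (d *+ k *m w) (rho *m w) (d *+ k) => p q r t.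
  by apply/rowP => j; rewrite !mxE; ring.
apply/negP; rewrite -ltNge dotDl -scaler_nat dotZl -/e.
rewrite -[k%:R * e]opprK -mulrN subr_lt0 -ltr_pdivrMr ?oppr_gt0 //.
apply: le_lt_trans (ler_norm _) _; apply: lt_le_trans (archi_boundP _) _ => //.
by rewrite ler_nat.
Qed.

(** Stated for any [P] supported in the root cone: it is used both for the full
    partition function and for [part_hat]. *)
Lemma weyl_sum_stable (P : E -> Zpq) nu mu :
  (forall x, P x != 0 -> root_cone S x) ->
  exists k0 : nat, forall k, (k0 <= k)%N ->
    \sum_(w \in weyl S [set: 'I_n]) sign_char w *
      P ((nu + rho_dia *+ k + rho) *m w - (mu + rho_dia *+ k) - rho) =
    \sum_(w \in weyl S J) sign_char w * P ((nu + rho_bar) *m w - mu - rho_bar).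
Proof.
move=> Psupp.
have /choice[kf kfP] w : exists k0 : nat, forall k, (k0 <= k)%N ->
    weyl S [set: 'I_n] w -> ~ weyl S J w ->
    P ((nu + rho_dia *+ k + rho) *m w - (mu + rho_dia *+ k) - rho) = 0.
  have [[wW wJ]|h] := pselect (weyl S [set: 'I_n] w /\ ~ weyl S J w).
    have [k0 k0P] := cone_escape nu mu wW wJ; exists k0 => k kk0 _ _.
    by apply: contrapT => /eqP/Psupp; exact: k0P.
  by exists 0%N => k _ wW wJ; case: h.
have /finite_seqP[s Ws] := finite_weyl S [set: 'I_n].
exists (\max_(w <- s) kf w)%N => k kk0.
rewrite -(@fsbig_widen _ _ _ _ (weyl S J)); first last.
- move=> w [wW wJ] /=; rewrite (kfP w) ?mulr0 //; apply: leq_trans kk0.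
  by apply: leq_bigmax_seq => //; move: wW; rewrite Ws.
- by move=> w; apply: weyl_sub.
apply: eq_fsbigr => w; rewrite inE => wJ; congr (_ * P _).
have := rho_dia_fix wJ; have := bar_dia S J rho.
move: (rho_bar) (rho_dia) => b d <- dw.
rewrite !mulmxDl -[d *+ k]scaler_nat -scalemxAl dw.
move: (nu *m w) (k%:R *: d) (b *m w) => x y z.
by apply/rowP => j; rewrite !mxE; ring.
Qed.

(** The coefficient whose value at kappa + rho_bar is the stable b; as a function
    of [x] on the whole space it is antisymmetric under the parabolic
    subgroup. *)
Definition alt_hat nu x : Zpq :=
  \sum_(w \in weyl S J) sign_char w * part_hat S J ((nu + rho_bar) *m w - x).

Lemma bstabE nu kappa : bstab S J nu kappa = alt_hat nu (kappa + rho_bar).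
Proof.
have [k0 k0P] := weyl_sum_stable nu kappa (@part_hat_supp _ _ S J).
have e k : (k0 <= k)%N ->
    bp S J (nu + rho_dia *+ k) (kappa + rho_dia *+ k) = alt_hat nu (kappa + rho_bar).
  move=> kk; rewrite /bp k0P //; apply: eq_fsbigr => w _.
  by rewrite opprD addrA.
apply: xget_unique; first by exists k0.
move=> y [k1 k1P]; rewrite -(k1P (maxn k0 k1)) ?leq_maxr //.
by rewrite e ?leq_maxl.
Qed.

Lemma alt_hat_srefl nu x i : i \in J -> alt_hat nu (x *m srefl S i) = - alt_hat nu x.
Proof.
move=> iJ; rewrite /alt_hat -mulN1r mulr_fsumr.
have inv w : w *m srefl S i *m srefl S i = w by rewrite -mulmxA sreflK mulmx1.
have bij : set_bij (weyl S J) (weyl S J) (mulmx^~ (srefl S i)).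
  split=> [w wJ /=|w w' _ _ /= e|w wJ /=].
  - exact: weyl_mul (weyl_srefl S iJ).
  - by rewrite -[w]inv e inv.
  - by exists (w *m srefl S i) => //; exact: weyl_mul (weyl_srefl S iJ).
rewrite (reindex_fsbig _ _ _ _ bij); apply: eq_fsbigr => w _ /=.
rewrite mulmxA -mulmxBl part_hat_srefl // sign_char_mul sign_char_srefl.
by rewrite mulrN1 !mulNr mul1r.
Qed.

Lemma alt_hat_weyl nu x u : weyl S J u ->
  alt_hat nu (x *m u) = sign_char u * alt_hat nu x.
Proof.
move=> uJ; elim/(@weyl_ind R n S J) : uJ x => [|i w iJ _ IH] x.
  by rewrite mulmx1 sign_char1 mul1r.
rewrite mulmxA IH alt_hat_srefl //.
by rewrite sign_char_mul sign_char_srefl mulN1r mulrN mulNr.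
Qed.

Lemma alt_hat_singular nu x i : i \in J -> cpair x (alpha i) = 0 -> alt_hat nu x = 0.
Proof.
move=> iJ x0; have := alt_hat_srefl nu x iJ; rewrite mul_srefl x0 scale0r subr0 => e.
(* A polynomial over int equal to its opposite vanishes coefficientwise. *)
apply/polyP => j; apply/polyP => k; apply/eqP.
by rewrite !coef0 -eqNr -!coefN -e.
Qed.

End Stabilization.

(** * Summation over the chambers of the parabolic subgroup *)
Section Branching.
Context {R : realType} {n : nat}.
Variables (S : rootSystem R n) (J : {set 'I_n}).
Local Notation E := 'rV[R]_n.
Local Notation alpha := (simple_root S).
Local Notation rho := (rho S).
Local Notation rho_bar := (bar S J rho).
Variables (nu mu : E).
Local Notation M := (mu + rho_bar).

(** A finite set containing the support of [branching_term]: it makes the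
    exchange of summations legitimate. *)
Definition branching_box : set E :=
  \bigcup_(w in weyl S J)
    [set x | root_cone S ((nu + rho_bar) *m w - x) /\ root_cone S (x - M)].

Lemma finite_branching_box : finite_set branching_box.
Proof.
apply: bigcup_finite; first exact: finite_weyl.
by move=> w _; exact: finite_root_cone_interval.
Qed.

Definition branching_term x : Zpq := alt_hat S J nu x * part_bar S J (x - M).

Lemma branching_term_supp x : branching_term x != 0 -> branching_box x.
Proof.
rewrite mulf_eq0 negb_or => /andP[/fsum_neq0[w wJ]].
rewrite mulf_eq0 negb_or => /andP[_ /part_hat_supp h1] /part_bar_supp h2.
by exists w.
Qed.

Lemma part_pqE w : weyl S J w ->
  part_pq S J ((nu + rho_bar) *m w - mu - rho_bar) =
  \sum_(x \in branching_box)
     part_hat S J ((nu + rho_bar) *m w - x) * part_bar S J (x - M).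
Proof.
move=> wJ; set X := _ *m w; rewrite /part_pq /series_mul.
(* The summation variable of the product is the argument X - x of part_hat. *)
pose g (x : E) : E := X - x.
have gK : involutive g by move=> x; rewrite /g opprB addrC subrK.
rewrite (@reindex_fsbigT _ _ _ E E g _ (inv_bij gK)).
rewrite [RHS](@fsbig_widen _ _ _ _ _ [set: E]) //; last first.
  move=> x [_ nx]; apply: contrapT => /eqP; rewrite mulf_eq0 negb_or => /andP[h1 h2].
  apply: nx; exists w => //; split; first exact: part_hat_supp h1.
  exact: part_bar_supp h2.
apply: eq_fsbigr => x _; congr (_ * part_bar _ _ _); rewrite /g opprB.
by apply/rowP => j; rewrite !mxE; ring.
Qed.

Lemma stable_sum_regroup :
  \sum_(w \in weyl S J)
     sign_char w * part_pq S J ((nu + rho_bar) *m w - mu - rho_bar) =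
  \sum_(x \in [set: E]) branching_term x.
Proof.
rewrite -(@fsbig_widen _ _ _ _ branching_box) //; last first.
  by move=> x [_ nx]; apply: contrapT => /eqP/branching_term_supp.
transitivity (\sum_(w \in weyl S J) \sum_(x \in branching_box)
    sign_char w * part_hat S J ((nu + rho_bar) *m w - x) * part_bar S J (x - M)).
  apply: eq_fsbigr => w; rewrite inE => wJ; rewrite part_pqE // mulr_fsumr.
  by apply: eq_fsbigr => x _; rewrite mulrA.
rewrite exchange_fsbig; [|exact: finite_weyl|exact: finite_branching_box].
by apply: eq_fsbigr => x _; rewrite /branching_term mulr_fsuml.
Qed.

Definition chamber_map (p : E * 'M[R]_n) : E := (p.1 + dia S J mu + rho_bar) *m p.2.

Lemma cpair_chamber lam i : i \in J ->
  cpair (lam + dia S J mu + rho_bar) (alpha i) = cpair lam (alpha i) + 1.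
Proof. by move=> iJ; rewrite !cpairDl cpair_dia cpair_bar iJ cpair_rho addr0. Qed.

(** Each (lambda + mu_dia + rho_bar) is strictly dominant for J, so two of them in
    the same orbit are equal, with trivial stabilizer. *)
Lemma chamber_map_inj :
  set_inj (dominant_bar S J `*` weyl S J) chamber_map.
Proof.
move=> [x u] [y w]; rewrite !in_setE => -[/= [_ xd] uJ] [/= [_ yd] wJ].
rewrite /chamber_map /= => e.
have e' : (x + dia S J mu + rho_bar) *m (u *m w^T) = y + dia S J mu + rho_bar.
  by rewrite mulmxA e (weyl_mulK _ wJ).
have uw1 : u *m w^T = 1%:M.
  apply: (@weyl_regular_id _ _ S J _ (x + dia S J mu + rho_bar)).
  - exact: weyl_mul (weyl_tr wJ).
  - by move=> i iJ; rewrite cpair_chamber // ltr_wpDl // cpair_ge0 ?alpha_neq0 // xd.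
  - move=> i iJ; rewrite e' cpair_chamber // addr_ge0 //.
    by rewrite cpair_ge0 ?alpha_neq0 // yd.
congr (_, _).
  by move: e'; rewrite uw1 mulmx1 => /addIr/addIr.
by rewrite -[u]mulmx1 -(weyl_Vmul wJ) mulmxA uw1 mul1mx.
Qed.

Hypothesis hmu : weights S mu.

Lemma rho_bar_int j : cpair rho_bar (alpha j) \is a Num.int.
Proof. by rewrite cpair_bar; case: ifP => _; rewrite ?cpair_rho ?rpred1 ?rpred0. Qed.

(** Move [x] into the dominant chamber of J.  The result is a weight, because
    bar P is supported in the root cone, and it is not on a wall, because
    [alt_hat] does not vanish; so all its pairings with the alpha_i, i in J, are at
    least 1, and subtracting rho_bar leaves it dominant. *)
Lemma chamber_map_surj x : branching_term x != 0 ->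
  exists2 p, (dominant_bar S J `*` weyl S J) p & chamber_map p = x.
Proof.
rewrite mulf_eq0 negb_or => /andP[ax /part_bar_supp px].
have [u uJ ud] := weyl_dominant S J x.
have xint : forall j, cpair x (alpha j) \is a Num.int.
  move=> j; rewrite -(subrK M x) cpairDl rpredD ?(root_cone_weights px) //.
  rewrite cpairDl rpredD ?rho_bar_int //; exact: (weightsP S mu).1.
have xuint := weyl_weights uJ xint.
pose lam := x *m u - rho_bar - dia S J mu.
have lamE : lam + dia S J mu + rho_bar = x *m u by rewrite /lam !subrK.
have lamP j : cpair lam (alpha j) =
    cpair (x *m u) (alpha j) - cpair rho_bar (alpha j)
      - cpair (dia S J mu) (alpha j).
  by rewrite /lam !cpairDl !cpairNl.
exists (lam, u^T); last by rewrite /chamber_map /= lamE (weyl_mulK _ uJ).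
split=> /=; last exact: weyl_tr.
split.
  apply/weightsP => j; rewrite lamP !rpredB ?rho_bar_int //.
  rewrite cpair_dia; case: ifP => _; rewrite ?rpred0 //.
  exact: (weightsP S mu).1.
move=> i iJ; rewrite -cpair_ge0 ?alpha_neq0 // lamP.
rewrite cpair_bar cpair_dia iJ cpair_rho subr0.
have x0 : cpair (x *m u) (alpha i) != 0.
  apply: contraNneq ax => /(alt_hat_singular nu iJ) /eqP.
  rewrite alt_hat_weyl // => /eqP/(congr1 (fun z => sign_char u * z)).
  by rewrite mulr0 mulrA (sign_char_sqr uJ) mul1r => ->.
by rewrite subr_ge0 -(ger0_norm (ud i iJ)) norm_intr_ge1.
Qed.

Lemma branching_sum :
  \sum_(x \in [set: E]) branching_term x =
  \sum_(lam \in dominant_bar S J)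
    bstab S J nu (lam + dia S J mu) * Kbar S J lam (bar S J mu).
Proof.
have shift lam u : weyl S J u ->
    (lam + rho_bar) *m u - bar S J mu - rho_bar = chamber_map (lam, u) - M.
  move=> uJ; rewrite /chamber_map /= [lam + _ + _]addrAC [in RHS]mulmxDl.
  rewrite [dia _ _ _ *m _](weyl_fix uJ).
    rewrite -[X in _ - (X + _)](bar_dia S J mu).
    by apply/rowP => j; rewrite !mxE; ring.
  by move=> i iJ; rewrite cpair_dia iJ.
have termE lam u : weyl S J u -> branching_term (chamber_map (lam, u)) =
    bstab S J nu (lam + dia S J mu) *
    (sign_char u * part_bar S J ((lam + rho_bar) *m u - bar S J mu - rho_bar)).
  move=> uJ; rewrite bstabE /branching_term shift // {1}/chamber_map /=.
  rewrite alt_hat_weyl //.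
  by rewrite mulrCA mulrA.
(* Only the lambda of a finite set L contribute, so that the double sum over
   lambda and u can be written as a sum over pairs. *)
pose L := [set lam | dominant_bar S J lam /\
  exists2 u, weyl S J u & branching_box (chamber_map (lam, u))].
have finL : finite_set L.
  pose g (p : E * 'M[R]_n) : E := p.1 *m p.2^T - rho_bar - dia S J mu.
  apply: (@sub_finite_set _ _ (g @` (branching_box `*` weyl S J))).
    move=> lam [_ [u uJ hu]]; exists (chamber_map (lam, u), u) => //.
    by rewrite /g /chamber_map /= (weyl_mulK _ uJ) !addrK.
  apply: finite_image; apply: finite_setX; last exact: finite_weyl.
  exact: finite_branching_box.
have LsubD : L `<=` dominant_bar S J by move=> lam [].
rewrite -(@fsbig_widen _ _ _ _ L (dominant_bar S J)) //; last first.
  move=> lam [lamd nL]; apply: contrapT => /eqP.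
  rewrite mulf_eq0 negb_or => /andP[b0].
  rewrite /Kbar => /fsum_neq0[u uJ ku].
  apply: nL; split=> //; exists u => //; apply: branching_term_supp.
  by rewrite termE // mulf_neq0.
transitivity (\sum_(lam \in L) \sum_(u \in weyl S J)
    branching_term (chamber_map (lam, u))).
  rewrite pair_fsbig //; last exact: finite_weyl.
  rewrite -(@fsbig_widen _ _ _ _ (chamber_map @` (L `*` weyl S J))) //; last first.
    move=> x [_ nx]; apply: contrapT => /eqP tx; apply: nx.
    have [[lam u] [/= lamd uJ] e] := chamber_map_surj tx.
    exists (lam, u) => //; split=> //=; split=> //; exists u => //.
    by rewrite e; exact: branching_term_supp.
  rewrite fsbig_image.
    by apply: eq_fsbigr => -[].
  move=> p q; rewrite !in_setE => -[/LsubD pd pw] [/LsubD qd qw].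
  by apply: chamber_map_inj; rewrite in_setE.
apply: eq_fsbigr => lam _; rewrite /Kbar mulr_fsumr.
by apply: eq_fsbigr => u; rewrite inE => uJ; rewrite termE.
Qed.

End Branching.

Theorem theorem5p4 (R : realType) (n : nat) (S : rootSystem R n)
    (J : {set 'I_n}) (nu mu : 'rV[R]_n)
    (hnu : dominant S nu) (hmu : weights S mu) :
  exists k0 : nat,
    (forall k : nat, (k0 <= k)%N ->
      Kpq S J (nu + dia S J (rho S) *+ k) (mu + dia S J (rho S) *+ k) =
      \sum_(lambda \in dominant_bar S J)
        bstab S J nu (lambda + dia S J mu) * Kbar S J lambda (bar S J mu)) /\
    (forall k k' : nat, (k0 <= k)%N -> (k0 <= k')%N ->
      Kpq S J (nu + dia S J (rho S) *+ k) (mu + dia S J (rho S) *+ k) =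
      Kpq S J (nu + dia S J (rho S) *+ k') (mu + dia S J (rho S) *+ k')).
Proof.
have [k0 k0P] := weyl_sum_stable J nu mu (@part_pq_supp _ _ S J).
have KE k : (k0 <= k)%N ->
    Kpq S J (nu + dia S J (rho S) *+ k) (mu + dia S J (rho S) *+ k) =
    \sum_(lambda \in dominant_bar S J)
      bstab S J nu (lambda + dia S J mu) * Kbar S J lambda (bar S J mu).
  by move=> kk; rewrite /Kpq k0P // stable_sum_regroup branching_sum.
by exists k0; split=> // k k' kk kk'; rewrite !KE.
Qed.
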